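(* Let $G$ be a connected graph on $n$ vertices with $n \geqslant 2$ and let $H$ be a $k$-regular graph on $m$ vertices. If $G$ has no periodic vertices, then the neighborhood corona $G \star H$ has no periodic vertices, and therefore $G \star H$ has no perfect state transfer (between any two distinct vertices).
   Context: Graphs are finite, simple and undirected. For a graph $X$ with adjacency matrix $A_X$, the transition matrix is $U(t)=\exp(-\mathtt{i} t A_X)$, $t\in\mathbb{R}^+$ (positive reals), $\mathtt{i}=\sqrt{-1}$; $\mathbf{e}_u$ denotes the characteristic (standard basis) vector of the vertex $u$. $X$ is periodic at vertex $u$ (i.e. $u$ is a periodic vertex) if there are a time $t\in\mathbb{R}^+$ and a complex scalar $\gamma$ with $|\gamma|=1$ such that $U(t)\mathbf{e}_u=\gamma\mathbf{e}_u$. For distinct vertices $u,v$, $X$ has perfect state transfer from $u$ to $v$ if there are $t\in\mathbb{R}^+$ and $\gamma\in\mathbb{C}$, $|\gamma|=1$, with $U(t)\mathbf{e}_u=\gamma\mathbf{e}_v$. Neighborhood corona: for graphs $G$ on $n$ vertices and $H$ on $m$ vertices, $G\star H$ is the graph obtained from one copy of $G$ and $n$ vertex-disjoint copies of $H$ by joining every neighbor (in $G$) of the $i$th vertex of $G$ to every vertex of the $i$th copy of $H$. Its vertex set is $V(G)\times(\{0\}\cup V(H))$, where $(v,0)$ is the vertex $v$ of $G$ and $(v,w)$ with $w\in V(H)$ is the vertex $w$ in the copy of $H$ associated with $v$; thus $(v,0)\sim(v',0)$ iff $vv'\in E(G)$, $(v,w)\sim(v,w')$ iff $ww'\in E(H)$,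 and $(v,w)\sim(v',0)$ iff $v'$ is a neighbor of $v$ in $G$ (for $w,w'\in V(H)$), with no other edges. *)

(* Defs.v *)
From HB Require Import structures.
From mathcomp Require Import all_boot all_order all_algebra.
From mathcomp Require Import complex.
From mathcomp Require Import all_classical all_reals all_analysis.

Set Implicit Arguments.
Unset Strict Implicit.
Unset Printing Implicit Defensive.

Import Order.TTheory GRing.Theory Num.Theory.
Import numFieldNormedType.Exports.

Local Open Scope classical_set_scope.
Local Open Scope ring_scope.

Record sgraph (V : finType) := SGraph {
  adj : rel V;
  adj_sym : symmetric adj;
  adj_irr : irreflexive adj
}.

Definition gconnected (V : finType) (G : sgraph V) : Prop :=
  forall u v : V, connect (adj G) u v.

Definition gregular (V : finType) (G : sgraph V) (k : nat) : Prop :=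
  forall v : V, #|[pred w | adj G v w]| = k.

(* [(v, None)] is the vertex (v, 0) of the copy of G, and [(v, Some w)] is the
   vertex w of the copy of H attached to v. *)
Definition ncorona_adj (V W : finType) (G : sgraph V) (H : sgraph W) :
    rel (V * option W) :=
  fun x y => match x, y with
    | (v, None), (v', None) => adj G v v'
    | (v, Some w), (v', Some w') => (v == v') && adj H w w'
    | (v, Some _), (v', None) => adj G v v'
    | (v, None), (v', Some _) => adj G v' v
    end.

Lemma ncorona_sym (V W : finType) (G : sgraph V) (H : sgraph W) :
  symmetric (ncorona_adj G H).
Proof.
by move=> [v [w|]] [v' [w'|]] //=; rewrite ?[v == v']eq_sym adj_sym.
Qed.

Lemma ncorona_irr (V W : finType) (G : sgraph V) (H : sgraph W) :
  irreflexive (ncorona_adj G H).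
Proof. by move=> [v [w|]] /=; rewrite adj_irr ?andbF. Qed.

Definition ncorona (V W : finType) (G : sgraph V) (H : sgraph W) :
    sgraph (V * option W)%type :=
  SGraph (@ncorona_sym V W G H) (@ncorona_irr V W G H).

(* The numeric-field packaging of R[i]: it is through this structure that
   R[i], and matrices over it, receive their topology. *)
Definition Cplx (R : realType) : numClosedFieldType := complex R.

(* The limit is taken in the topology of entrywise convergence; the series
   converges for every A, so the default value of [limn] is never used. *)
Definition mxexp (R : realType) (n : nat) (A : 'M[Cplx R]_n) : 'M[Cplx R]_n :=
  limn (series (fun k : nat => (k`!%:R : Cplx R)^-1 *: A ^+ k)).

Section QuantumWalk.
Variables (R : realType) (V : finType).

(* Vertices index rows and columns through the enumeration of V. *)
Definition adjmx (X : sgraph V) : 'M[Cplx R]_#|V| :=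
  \matrix_(i, j) (adj X (enum_val i) (enum_val j))%:R.

Definition evec (u : V) : 'cV[Cplx R]_#|V| := delta_mx (enum_rank u) 0.

Definition transition (X : sgraph V) (t : R) : 'M[Cplx R]_#|V| :=
  mxexp (- ('i * (t%:C)%C : Cplx R) *: adjmx X).

Definition periodic_at (X : sgraph V) (u : V) : Prop :=
  exists (t : R) (gamma : Cplx R),
    [/\ 0 < t, `|gamma| = 1 & transition X t *m evec u = gamma *: evec u].

Definition perfect_state_transfer (X : sgraph V) (u v : V) : Prop :=
  exists (t : R) (gamma : Cplx R),
    [/\ 0 < t, `|gamma| = 1 & transition X t *m evec u = gamma *: evec v].

End QuantumWalk.

(* Main.v *)
Require Import Defs.
From mathcomp Require Import all_boot all_order all_algebra.
From mathcomp Require Import complex spectral ring lra zify.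
From mathcomp Require Import all_classical all_reals all_analysis.

(* Testing [U(t) e_u = g e_v] against the eigenfunctions [x] of [X] turns it
   into the scalar conditions [exp(-i t l) x_u = g x_v].  An eigenfunction of
   [G] for [l <> 0] lifts to the corona for the two roots of
   [mu^2 - (l + k) mu + l k - m l^2], whose sum is [l + k].  If the corona is
   periodic at [(v, o)] with phase [g], then [exp(-i t (l + k)) = g^2] for all
   nonzero [l] in the support of [v], so [G] is periodic at [v] unless [0] is
   in that support.  In that case [g] is [1] or [exp(-i t k)], both roots lie in
   a coset of [(2 pi / t) Z], and [2 pi / t] satisfies a quadratic equation
   depending on [l].  The support contains two distinct nonzero eigenvalues,
   since [A^2 - l A] has a positive diagonal entry at a non-isolated [v].
   Comparing their equations makes [k] commensurable with [2 pi / t], and [G]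
   is periodic at [v] at a multiple of [t].  Perfect state transfer from [u]
   implies periodicity at [u] because the adjacency matrix is real symmetric. *)

Set Implicit Arguments.
Unset Strict Implicit.
Unset Printing Implicit Defensive.

Import Order.TTheory GRing.Theory Num.Theory.
Import numFieldNormedType.Exports.

Local Open Scope classical_set_scope.
Local Open Scope ring_scope.

(** * The phase [expi]: its kernel and its power series *)

Section Expi.
Variable R : realType.
Implicit Types x y t : R.

(* [exp(- i x)]; the sign is that of the transition matrix. *)
Definition expi x : Cplx R := (cos x -i* sin x)%C.

Lemma expi0 : expi 0 = 1.
Proof. by rewrite /expi cos0 sin0 oppr0. Qed.

Lemma expiD x y : expi (x + y) = expi x * expi y.
Proof.
rewrite /expi cosD sinD; apply/eqP; rewrite eq_complex /=.
by apply/andP; split; apply/eqP; ring.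
Qed.

Lemma expi_conj x : ((expi x)^*)%C = expi (- x).
Proof. by rewrite /expi cosN sinN. Qed.

Lemma expi_mulVr x : expi x * expi (- x) = 1.
Proof. by rewrite -expiD subrr expi0. Qed.

Lemma normr_expi x : `|expi x| = 1.
Proof. by rewrite normc_def /= sqrrN cos2Dsin2 sqrtr1. Qed.

Lemma expi_natmul n x : expi (n%:R * x) = expi x ^+ n.
Proof.
elim: n => [|n IHn]; first by rewrite mul0r expi0 expr0.
by rewrite -natr1 mulrDl mul1r expiD IHn exprSr.
Qed.

Lemma expi_2pi : expi (pi *+ 2) = 1.
Proof. by rewrite /expi cos2pi sin2pi oppr0. Qed.

Lemma expi_eq1_int (z : int) : expi (z%:~R * (pi *+ 2)) = 1.
Proof.
case: z => n; first by rewrite -pmulrn expi_natmul expi_2pi expr1n.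
by rewrite NegzE mulrNz mulNr -expi_conj -pmulrn expi_natmul expi_2pi expr1n
  conjc1.
Qed.

(** Removing the integral part of [x / (2 pi)] leaves [y] in [[0, 2 pi)] with [cos y = 1]. The
    double angle formula gives [sin (y / 2) = 0], and [sin] is positive strictly between [0] and
    [pi], so [y = 0]. *)
Lemma expi_eq1 x : expi x = 1 -> exists z : int, x = z%:~R * (pi *+ 2).
Proof.
have pi0 := pi_gt0 R; have p2 : 0 < pi *+ 2 :> R by rewrite mulrn_wgt0.
move=> e1; pose z := Num.floor (x / (pi *+ 2)); exists z.
have /andP[] := floor_itv (x / (pi *+ 2)).
rewrite -/z ler_pdivlMr // ltr_pdivrMr // intrD mulrDl mul1r => le_zx lt_xz.
pose y := x - z%:~R * (pi *+ 2).
have : expi y = 1.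
  by rewrite expiD e1 mul1r -mulNr -mulrNz expi_eq1_int.
case => cosy _; have : cos ((y / 2) *+ 2) = 1 by rewrite -mulr_natr divfK.
rewrite cos_mulr2n cos2sin2 => sy.
have {}sy : sin (y / 2) = 0 by apply/eqP; rewrite -sqrf_eq0; apply/eqP; lra.
apply/eqP; rewrite -subr_eq0 -/y -[_ == _]negbK; apply/negP => y0.
have y1 : 0 < y / 2 < pi.
  have : 0 < y by rewrite lt_def y0 subr_ge0.
  by move: lt_xz; rewrite /y -mulr_natr => ? ?; apply/andP; split; lra.
by have := sin_gt0_pi y1; rewrite sy ltxx.
Qed.

Lemma expi_coeff x k :
  (k`!%:R : Cplx R)^-1 * (- ('i * (x%:C)%C)) ^+ k =
  (cos_coeff x k -i* sin_coeff x k)%C.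
Proof.
have -> : (k`!%:R : Cplx R)^-1 = ((k`!%:R : R)^-1)%:C%C.
  by rewrite -(rmorph_nat (real_complex R)) fmorphV.
rewrite -mulNr exprMn -rmorphXn /cos_coeff /sin_coeff /=.
(* Even powers of [- 'i] are real, odd ones imaginary; for odd [k] the exponents [k./2] and
   [k.-1./2] agree. *)
have -> : (- 'i : Cplx R) ^+ k =
    ((~~ odd k)%:R * (-1) ^+ k./2 -i* ((odd k)%:R * (-1) ^+ k.-1./2))%C.
  rewrite -{1}[k]odd_double_half exprD -mul2n exprM sqrrN sqrCi.
  rewrite -(rmorphN1 (real_complex R)) -rmorphXn /=.
  have -> : k.-1./2 = (if odd k then k./2 else k.-1./2).
    by case: ifP => // ok; rewrite -{1}[k]odd_double_half ok doubleK.
  rewrite -complexiE.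
  by case: (odd k); apply/eqP; rewrite eq_complex /=; apply/andP;
    split; apply/eqP; rewrite ?expr1 ?expr0 /=; ring.
by apply/eqP; rewrite eq_complex /=; apply/andP; split; apply/eqP;
  rewrite /exprz /=; ring.
Qed.

Lemma cvg_complex (u v : R^nat) a b :
  u @ \oo --> a -> v @ \oo --> b ->
  (fun n => (u n -i* v n)%C : Cplx R) @ \oo --> ((a -i* b)%C : Cplx R).
Proof.
move=> /cvgrPdist_lt ua /cvgrPdist_lt vb; apply/cvgrPdist_lt => -[e e'].
(* In the order of [Cplx R], a positive radius has zero imaginary part, so real estimates
   suffice. *)
rewrite ltcE /= => /andP[/eqP -> e0].
have e2 : 0 < e / 2 by rewrite divr_gt0.
near=> n.
have -> : ((a -i* b)%C - (u n -i* v n)%C : Cplx R) =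
   ((a - u n)%:C)%C - 'i%C * ((b - v n)%:C)%C.
  by apply/eqP; rewrite eq_complex /=; apply/andP; split; apply/eqP; ring.
apply: le_lt_trans (ler_normB _ _) _.
rewrite normrM !normc_def /= expr0n expr1n add0r sqrtr1 mul1r.
rewrite ?expr0n ?addr0 /= !sqrtr_sqr -rmorphD /=.
rewrite -[(e +i* 0)%C]/((e%:C)%C) ltcR (splitr e) ltrD //.
  by near: n; exact: ua.
by near: n; exact: vb.
Unshelve. all: by end_near.
Qed.

Lemma cvg_series_expi x :
  series (fun k => (k`!%:R : Cplx R)^-1 * (- ('i * (x%:C)%C)) ^+ k) @ \oo
    --> expi x.
Proof.
have -> : series (fun k => (k`!%:R : Cplx R)^-1 * (- ('i * (x%:C)%C)) ^+ k) =
   (fun n => (series (cos_coeff x) n -i* series (sin_coeff x) n)%C).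
  apply/funext => n; rewrite !seriesEnat /=.
  elim: n => [|n IHn]; first by rewrite !big_geq // oppr0.
  rewrite !big_nat_recr //= IHn expi_coeff.
  by apply/eqP; rewrite eq_complex /= opprD !eqxx.
apply: cvg_complex; rewrite ?cos.unlock ?sin.unlock.
  exact: is_cvg_series_cos_coeff.
exact: is_cvg_series_sin_coeff.
Qed.

End Expi.

(** * Powers and eigenvectors of diagonalizable matrices *)

Lemma expr_similar_diag (K : fieldType) n (P : 'M[K]_n) (c : 'I_n -> K) k :
  P \in unitmx -> (invmx P *m diag_mx (\row_j c j) *m P) ^+ k =
                  invmx P *m diag_mx (\row_j c j ^+ k) *m P.
Proof.
move=> Pu; elim: k => [|k IHk].
  rewrite expr0 (_ : \row_j _ = const_mx 1) ?diag_const_mx ?mulmx1 ?mulVmx //.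
  by apply/rowP => j; rewrite !mxE expr0.
rewrite exprS IHk -mulmxE !mulmxA (mulmxK Pu) -(mulmxA _ _ (diag_mx _)).
rewrite mulmx_diag; congr (_ *m diag_mx _ *m _).
by apply/rowP => j; rewrite !mxE exprS.
Qed.

Lemma similar_diag_mulmx (K : fieldType) n (P A : 'M[K]_n) (D : 'rV_n) :
  P \in unitmx -> A = invmx P *m diag_mx D *m P -> P *m A = diag_mx D *m P.
Proof. by move=> Pu ->; rewrite !mulmxA mulmxV // mul1mx. Qed.

Lemma scale_similar_diag (K : fieldType) n (P : 'M[K]_n) (D : 'rV_n) (a : K) :
  a *: (invmx P *m diag_mx D *m P) = invmx P *m diag_mx (a *: D) *m P.
Proof. by rewrite scalemxAl scalemxAr -linearZ. Qed.

(** The coordinates [y] of [x] along the rows of [P] vanish wherever [D 0 j] differs from [l], so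
    only the entries of [E] equal to [e] act on [x]. *)
Lemma similar_diag_eigenrow (K : fieldType) n (P A : 'M[K]_n) (D E : 'rV_n)
    (x : 'rV_n) (l e : K) :
  P \in unitmx -> A = invmx P *m diag_mx D *m P -> x *m A = l *: x ->
  (forall j, D 0 j = l -> E 0 j = e) ->
  x *m (invmx P *m diag_mx E *m P) = e *: x.
Proof.
move=> Pu AE xA DE; pose y := x *m invmx P.
have xE : x = y *m P by rewrite mulmxKV.
have yD : y *m diag_mx D = l *: y.
  by rewrite scalemxAl -xA AE -!mulmxA mulmxV // mulmx1.
rewrite !mulmxA -/y [in RHS]xE scalemxAl; congr (_ *m P).
clearbody y; apply/rowP => j; move/rowP/(_ j): yD; rewrite !mul_mx_diag !mxE.
have [-> _|y0] := eqVneq (y 0 j) 0; first by rewrite mul0r mulr0.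
by rewrite [l * _]mulrC => /(mulfI y0) /DE ->; rewrite mulrC.
Qed.

(** The zero function qualifies for every [l]; that [l] lies in the support of [v] is expressed by
    an [x] with [x v != 0]. *)
Definition eigenfun (K : comNzRingType) (V : finType) (X : sgraph V)
    (x : V -> K) (l : K) :=
  forall v, \sum_u (adj X v u)%:R * x u = l * x v.

(** * Spectral form of periodicity and state transfer *)

Section Spectral.
Variable R : realType.

(** Expanding along the fixed matrices [E j] splits the matrix series into finitely many scalar
    exponential series. *)
Lemma mxexp_diag n (P : 'M[Cplx R]_n) (th : 'I_n -> R) : P \in unitmx ->
  mxexp (invmx P *m diag_mx (\row_j - ('i * ((th j)%:C)%C)) *m P) =
  invmx P *m diag_mx (\row_j expi (th j)) *m P.
Proof.
move=> Pu; pose E j := invmx P *m delta_mx j j *m P.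
have diagE (c : 'I_n -> Cplx R) :
    invmx P *m diag_mx (\row_j c j) *m P = \sum_j c j *: E j.
  rewrite diag_mx_sum_delta mulmx_sumr mulmx_suml; apply: eq_bigr => j _.
  by rewrite mxE -scalemxAr -scalemxAl.
have expE (c : 'I_n -> Cplx R) k :
    (invmx P *m diag_mx (\row_j c j) *m P) ^+ k =
    invmx P *m diag_mx (\row_j c j ^+ k) *m P.
  exact: expr_similar_diag.
rewrite diagE; apply: (cvg_lim (@norm_hausdorff _ 'M[Cplx R]_n)).
set s := series _.
have -> : s = (fun N => \sum_j
    series (fun k => (k`!%:R : Cplx R)^-1 * (- ('i * ((th j)%:C)%C)) ^+ k) N
      *: E j).
  apply/funext => N; rewrite /s seriesEnat /=.
  under eq_bigr do rewrite expE diagE scaler_sumr.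
  rewrite exchange_big; apply: eq_bigr => j _.
  rewrite seriesEnat /= scaler_suml; apply: eq_bigr => k _.
  by rewrite scalerA.
apply: cvg_big => [|j _]; first exact: add_continuous.
by apply: cvgZr_tmp; exact: cvg_series_expi.
Qed.

Variables (V : finType) (X : sgraph V).

Lemma eigenfun_conj (x : V -> Cplx R) (l : R) :
  eigenfun X x (l%:C)%C -> eigenfun X (fun v => (x v)^*%C) (l%:C)%C.
Proof.
move=> xl v; rewrite -conjc_real -rmorphM -xl rmorph_sum; apply: eq_bigr => u _.
by rewrite rmorphM rmorph_nat.
Qed.

(** The adjacency matrix is Hermitian, hence diagonalizable with real spectrum. The rows of the
    diagonalizing matrix are left eigenvectors, and by symmetry of [adj] eigenfunctions. *)
Lemma eigenbasis : exists2 Pd : 'M[Cplx R]_#|V| * ('I_#|V| -> R),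
    Pd.1 \in unitmx /\
    adjmx R X = invmx Pd.1 *m diag_mx (\row_j ((Pd.2 j)%:C)%C) *m Pd.1
  & forall j, eigenfun X (fun v => Pd.1 j (enum_rank v)) ((Pd.2 j)%:C)%C.
Proof.
set A := adjmx R X.
have Ah : A \is hermsymmx.
  apply/is_hermitianmxP; rewrite expr0 scale1r; apply/matrixP => i j.
  by rewrite !mxE adj_sym; case: (adj X _ _); rewrite ?conjC1 ?conjC0.
have := orthomx_spectralP (hermitian_normalmx Ah).
have := hermitian_spectral_diag_real Ah.
have := spectral_unit A.
move: (spectralmx A) (spectral_diag A) => P D Pu /mxOverP Dr AE.
have DE : D = \row_j ((complex.Re (D 0 j))%:C)%C.
  by apply/rowP => j; rewrite !mxE RRe_real.
have PA := similar_diag_mulmx Pu AE.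
rewrite DE in AE; exists (P, fun j => complex.Re (D 0 j)) => //= j v.
move/matrixP/(_ j (enum_rank v)): PA; rewrite mul_diag_mx mxE [in RHS]mxE => PA.
rewrite RRe_real // big_enum_val -[RHS]PA; apply: eq_bigr => i _.
by rewrite mxE enum_valK enum_rankK adj_sym mulrC.
Qed.

Lemma eigenfun_complete (f : V -> Cplx R) :
  (forall (x : V -> Cplx R) (l : R), eigenfun X x (l%:C)%C ->
     \sum_u x u * f u = 0) ->
  forall u, f u = 0.
Proof.
have [[P d] /= [Pu _] Pd] := eigenbasis => f0 u.
have : P *m (\col_i f (enum_val i)) = 0.
  apply/matrixP => j k; rewrite !mxE -[RHS](f0 _ _ (Pd j)).
  by rewrite [RHS]big_enum_val; apply: eq_bigr => i _; rewrite mxE enum_valK.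
move/(congr1 (mulmx (invmx P))); rewrite mulKmx // mulmx0.
by move/matrixP/(_ (enum_rank u) 0); rewrite !mxE enum_rankK.
Qed.

Lemma mulmx_evec m (M : 'M[Cplx R]_(m, #|V|)) u i :
  (M *m evec R u) i 0 = M i (enum_rank u).
Proof. by rewrite -colE mxE. Qed.

(** An eigenfunction, read as a row, is a left eigenvector of the transition matrix. Conversely, the
    conditions for the rows of [P] suffice because [P] is invertible. *)
Lemma transition_eigenfun (t : R) (g : Cplx R) u v :
  transition X t *m evec R u = g *: evec R v <->
  forall (x : V -> Cplx R) (l : R), eigenfun X x (l%:C)%C ->
    expi (t * l) * x u = g * x v.
Proof.
have [[P d] /= [Pu AE] Pd] := eigenbasis.
have -> : transition X t = invmx P *m diag_mx (\row_j expi (t * d j)) *m P.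
  have DE : - ('i * (t%:C)%C) *: \row_j ((d j)%:C)%C =
            \row_j - ('i * ((t * d j)%:C)%C) :> 'rV[Cplx R]_#|V|.
    by apply/rowP => j; rewrite !mxE rmorphM mulNr mulrA.
  by rewrite /transition AE scale_similar_diag DE; exact: mxexp_diag.
split=> [Ut x l xl|Ht].
  have xA : (\row_i x (enum_val i)) *m adjmx R X =
            (l%:C)%C *: \row_i x (enum_val i).
    apply/rowP => i; rewrite [RHS]mxE mxE [in RHS]mxE -xl [RHS]big_enum_val.
    by apply: eq_bigr => k _; rewrite !mxE adj_sym mulrC.
  have := similar_diag_eigenrow (E := \row_j expi (t * d j)) (e := expi (t * l))
    Pu AE xA.
  have DE j : (\row_j ((d j)%:C)%C) 0 j = (l%:C)%C ->
      (\row_j expi (t * d j)) 0 j = expi (t * l).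
    by rewrite !mxE => -[->].
  move=> /(_ DE) xU; have := congr1 (mulmx (\row_i x (enum_val i))) Ut.
  rewrite mulmxA xU -scalemxAl -scalemxAr => /matrixP/(_ 0 0).
  by rewrite [LHS]mxE [RHS]mxE !mulmx_evec !mxE !enum_rankK.
apply: (can_inj (mulKmx Pu)).
rewrite mulmxA (similar_diag_mulmx Pu erefl) -mulmxA -scalemxAr.
apply/matrixP => j k; rewrite ord1 mul_diag_mx [RHS]mxE [LHS]mxE.
rewrite !mulmx_evec mxE.
exact: (Ht _ _ (Pd j)).
Qed.

(** Applying the phase condition to the conjugate of [x] and conjugating back gives
    [expi (t * l) * x v = g * x u]: transfer also runs from [v] to [u] at time [t], hence the return
    at time [2 t]. *)
Lemma perfect_state_transfer_periodic u v :
  perfect_state_transfer R X u v -> periodic_at R X u.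
Proof.
move=> [t [g [t0 g1 /transition_eigenfun H]]]; exists (t *+ 2), (g ^+ 2).
split; first by rewrite mulrn_wgt0.
  by rewrite normrX g1 expr1n.
apply/transition_eigenfun => x l xl.
have conjM (a b : Cplx R) : (a * b)^*%C = a^*%C * b^*%C by exact: rmorphM.
have gg : g * (g^*)%C = 1 by rewrite -sqr_normc g1 expr1n.
have /(congr1 conjc) := H _ _ (eigenfun_conj xl).
rewrite !conjM expi_conj !conjcK => /(congr1 ( *%R (g * expi (t * l)))).
rewrite mulrA -(mulrA g) expi_mulVr mulr1 mulrACA gg mul1r => E.
by rewrite mulr2n mulrDl expiD -mulrA (H _ _ xl) mulrCA -E mulrA expr2.
Qed.

(** Otherwise [l * (l - l0)] vanishes on the support of [v], and row [v] of [A^2 - l0 A], which is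
    [f], is zero by completeness. Yet [f v] counts the neighbors of [v]. *)
Lemma nonzero_eigenvalue_outside v w (l0 : R) : adj X v w ->
  exists (x : V -> Cplx R) (l : R),
    [/\ eigenfun X x (l%:C)%C, x v != 0, l != 0 & l != l0].
Proof.
move=> vw; apply: contrapT => nex.
pose f u : Cplx R :=
  \sum_w (adj X v w)%:R * (adj X w u)%:R - (l0%:C)%C * (adj X v u)%:R.
have /(_ v)/eqP : forall u, f u = 0.
  apply: eigenfun_complete => x l xl.
  under eq_bigr do rewrite mulrBr mulr_sumr.
  rewrite sumrB exchange_big /=.
  have -> : \sum_i \sum_u x u * ((adj X v i)%:R * (adj X i u)%:R) =
     ((l ^+ 2)%:C)%C * x v.
    rewrite rmorphXn /= -mulrA -xl mulr_sumr; apply: eq_bigr => i _.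
    rewrite mulrCA -xl mulr_sumr; apply: eq_bigr => u _; ring.
  have -> : \sum_u x u * ((l0%:C)%C * (adj X v u)%:R) = ((l0 * l)%:C)%C * x v.
    rewrite rmorphM /= -mulrA -xl mulr_sumr; apply: eq_bigr => u _; ring.
  have [->|xv0] := eqVneq (x v) 0; first by rewrite !mulr0 subrr.
  have [->|l_neq0] := eqVneq l 0; first by rewrite expr0n !mulr0 subrr.
  have [->|l_neql0] := eqVneq l l0; first by rewrite expr2 subrr.
  by exfalso; apply: nex; exists x, l.
rewrite /f adj_irr mulr0 subr0 psumr_eq0 => [|u _]; last by rewrite mulr_ge0.
move/allP/(_ w); rewrite mem_index_enum => /(_ isT).
by rewrite adj_sym [adj X w v]adj_sym vw mulr1 oner_eq0.
Qed.

End Spectral.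

(** * Lifting eigenfunctions to the corona *)

Section EigenCorona.
Variables (K : comNzRingType) (V W : finType) (G : sgraph V) (H : sgraph W).
Variable k : nat.
Hypothesis H_regular : gregular H k.

Lemma sum_corona (F : V * option W -> K) :
  \sum_p F p = \sum_v (F (v, None) + \sum_w F (v, Some w)).
Proof.
rewrite (eq_bigr (fun p => F (p.1, p.2))) => [|[] //].
rewrite -(pair_bigA _ (fun v o => F (v, o))) /=; apply: eq_bigr => v _.
rewrite (bigD1 None) //=; congr (_ + _).
rewrite (reindex_omap Some id) /=; last by case.
by apply: eq_bigl => w; rewrite eqxx.
Qed.

(** The lift is [a * x] on [G] and [b * x] on the copies of [H], each of which sees [b] as constant.
    The two equations are the rows of a 2 by 2 quotient eigenproblem; the guard [W ->] makes the
    second vacuous when [H] is empty. *)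
Lemma eigenfun_corona (x : V -> K) (l mu a b : K) :
  eigenfun G x l ->
  l * a + #|W|%:R * l * b = mu * a ->
  (W -> l * a + k%:R * b = mu * b) ->
  eigenfun (ncorona G H) (fun p => (if p.2 is Some _ then b else a) * x p.1) mu.
Proof.
move=> xl Ea Eb [v [w|]]; rewrite sum_corona /= mulrA.
  rewrite -(Eb w) big_split /= mulrDl; congr (_ + _).
    by under eq_bigr do rewrite mulrCA; rewrite -mulr_sumr xl mulrCA mulrA.
  rewrite (bigD1 v) //= [X in _ + X]big1 ?addr0; last first.
    by move=> u /negPf uv; rewrite big1 // => w' _; rewrite eq_sym uv mul0r.
  rewrite -mulr_suml -mulrA; congr (_ * _).
  rewrite -natr_sum -(H_regular w) -sum1_card [in RHS]big_mkcond /=.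
  congr (_%:R).
  by apply: eq_bigr => w' _; rewrite eqxx inE; case: adj.
rewrite -Ea big_split /= mulrDl; congr (_ + _).
  by under eq_bigr do rewrite mulrCA; rewrite -mulr_sumr xl mulrCA mulrA.
rewrite (eq_bigr (fun u => #|W|%:R * b * ((adj G v u)%:R * x u))); last first.
  by move=> u _; rewrite sumr_const adj_sym -[LHS]mulr_natl; ring.
by rewrite -mulr_sumr xl; ring.
Qed.

End EigenCorona.

(** * Phase constraints at a corona vertex *)

Section Corona.
Variables (R : realType) (V W : finType) (G : sgraph V) (H : sgraph W).
Variable k : nat.
Hypothesis H_regular : gregular H k.
Local Notation m := #|W|.
Implicit Types (x : V -> Cplx R) (l t mu : R).

Lemma corona_phases x l t (g : Cplx R) v (o : option W) : (0 < m)%N ->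
  transition (ncorona G H) t *m evec R (v, o) = g *: evec R (v, o) ->
  eigenfun G x (l%:C)%C -> x v != 0 -> l != 0 ->
  exists mu1 mu2, [/\ mu1 + mu2 = l + k%:R,
    mu1 * mu2 = l * k%:R - m%:R * l ^+ 2, expi (t * mu1) = g &
    expi (t * mu2) = g].
Proof.
move=> m0 /transition_eigenfun Ht xl xv l0.
have mr0 : 0 < m%:R :> R by rewrite ltr0n.
have l2 : 0 < m%:R * l ^+ 2 by rewrite mulr_gt0 // exprn_even_gt0.
have phase mu : mu * (mu - k%:R) = l * (mu - k%:R) + m%:R * l ^+ 2 ->
    expi (t * mu) = g.
  move=> E; have muk : mu - k%:R != 0.
    by apply/eqP => e0; move: E l2; rewrite e0 !mulr0 add0r => <-; rewrite ltxx.
  (* This pair solves the equation on the copies identically and turns the other one into [E]. Both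
     entries are nonzero, so the lift can be cancelled at [(v, o)] for either kind of [o]. *)
  pose a : Cplx R := ((mu - k%:R)%:C)%C; pose b : Cplx R := (l%:C)%C.
  have neq0 (r : R) : r != 0 -> (r%:C)%C != 0 :> Cplx R.
    by rewrite -(inj_eq (@complexI _)).
  have /Ht/= : eigenfun (ncorona G H)
      (fun p => (if p.2 is Some _ then b else a) * x p.1) (mu%:C)%C.
    apply: (eigenfun_corona H_regular xl) => [|_]; rewrite /a /b.
      rewrite -(rmorph_nat (real_complex R)) -!rmorphM -rmorphD E.
      by congr (_ %:C)%C; ring.
    rewrite -(rmorph_nat (real_complex R)) -!rmorphM -rmorphD.
    by congr (_ %:C)%C; ring.
  apply: mulIf; rewrite mulf_neq0 //.
  by case: o {Ht} => [w|]; exact: neq0.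
(* The square root of the discriminant of the quadratic in [mu]. *)
pose s := Num.sqrt ((l - k%:R) ^+ 2 + 4 * (m%:R * l ^+ 2)).
have s2 : s ^+ 2 = (l - k%:R) ^+ 2 + 4 * (m%:R * l ^+ 2).
  by rewrite sqr_sqrtr // addr_ge0 ?sqr_ge0 // mulr_ge0 // ltW.
exists ((l + k%:R + s) / 2), ((l + k%:R - s) / 2); split.
- by field.
- have -> : (l + k%:R + s) / 2 * ((l + k%:R - s) / 2) =
    ((l + k%:R) ^+ 2 - s ^+ 2) / 4 by field.
  by rewrite s2; field.
- apply: phase; apply/eqP; rewrite -subr_eq0; apply/eqP.
  transitivity ((s ^+ 2 - ((l - k%:R) ^+ 2 + 4 * (m%:R * l ^+ 2))) / 4).
    by field.
  by rewrite s2 subrr mul0r.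
- apply: phase; apply/eqP; rewrite -subr_eq0; apply/eqP.
  transitivity ((s ^+ 2 - ((l - k%:R) ^+ 2 + 4 * (m%:R * l ^+ 2))) / 4).
    by field.
  by rewrite s2 subrr mul0r.
Qed.

(** For [l = 0] the quotient problem decouples: [x] placed on [G] alone has eigenvalue [0], and on
    the copies alone [k]. The lift not vanishing at [(v, o)] determines [g]. *)
Lemma corona_zero_phase x t (g : Cplx R) v (o : option W) :
  transition (ncorona G H) t *m evec R (v, o) = g *: evec R (v, o) ->
  eigenfun G x (0%:C)%C -> x v != 0 ->
  g = expi (t * (if o is Some _ then k%:R else 0)).
Proof.
have real0 : (0 : R)%:C%C = 0 :> Cplx R by exact: rmorph0.
have realk : (k%:R : R)%:C%C = k%:R :> Cplx R by exact: rmorph_nat.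
move=> /transition_eigenfun Ht; rewrite real0 => xl xv; case: o Ht => [w|] Ht.
  have /Ht/= : eigenfun (ncorona G H)
      (fun p => (if p.2 is Some _ then 1 else 0) * x p.1) ((k%:R : R)%:C)%C.
    by rewrite realk; apply: (eigenfun_corona H_regular xl) => [|_]; ring.
  by rewrite mul1r => /(mulIf xv).
have /Ht/= : eigenfun (ncorona G H)
    (fun p => (if p.2 is Some _ then 0 else 1) * x p.1) ((0 : R)%:C)%C.
  by rewrite real0; apply: (eigenfun_corona H_regular xl) => [|_]; ring.
by rewrite mul1r => /(mulIf xv).
Qed.

Lemma corona_empty_periodic v (o : option W) : m = 0%N ->
  periodic_at R (ncorona G H) (v, o) -> periodic_at R G v.
Proof.
move=> m0 [t [g [t0 g1 /transition_eigenfun Ht]]]; exists t, g; split => //.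
apply/transition_eigenfun => x l xl.
have noW (w : W) : False by have := card0_eq m0 w; rewrite inE.
have /Ht/= : eigenfun (ncorona G H)
    (fun p => (if p.2 is Some _ then 0 else 1) * x p.1) (l%:C)%C.
  by apply: (eigenfun_corona H_regular xl) => [|/noW//]; rewrite m0; ring.
by case: o {Ht} => [w|]; [case: (noW w)|rewrite !mul1r].
Qed.

End Corona.

(* Eliminating [tau ^+ 2] leaves an integral linear relation between [tau] and
   [c], which is trivial only if [Q = Q' = 0]. *)
Lemma quadratic_pair_commensurable (R : realType) (tau c : R)
    (Q P Q' P' u d : int) :
  tau != 0 -> c != 0 -> u != 0 -> d != 0 -> P != P' ->
  Q%:~R * tau ^+ 2 + u%:~R * c * P%:~R * tau + d%:~R * c ^+ 2 = 0 ->
  Q'%:~R * tau ^+ 2 + u%:~R * c * P'%:~R * tau + d%:~R * c ^+ 2 = 0 ->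
  exists (n : nat) (z : int), (0 < n)%N /\ n%:R * c = z%:~R * tau.
Proof.
move=> tau0 c0 u0 d0 PP' E E'.
suff [N [z [N0 Nz]]] : exists N z : int, N != 0 /\ N%:~R * c = z%:~R * tau.
  case: N N0 Nz => n n0 Nz; first by exists n, z; rewrite lt0n.
  exists n.+1, (- z); split => //.
  by move: Nz; rewrite NegzE !mulrNz !mulNr -pmulrn => <-; rewrite opprK.
have L : d%:~R * (Q' - Q)%:~R * c = - u%:~R * (P * Q' - P' * Q)%:~R * tau :> R.
  apply: (mulIf c0); rewrite !rmorphB !rmorphM /=; apply/eqP; rewrite -subr_eq0.
  apply/eqP; transitivity (Q'%:~R * 0 - Q%:~R * 0 : R); last by ring.
  by rewrite -{1}E -E'; ring.
have [QQ'|QQ'] := eqVneq Q Q'; last first.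
  exists (d * (Q' - Q)), (- u * (P * Q' - P' * Q)); split.
    by rewrite mulf_neq0 // subr_eq0 eq_sym.
  by rewrite !rmorphM /= mulrNz.
have Q0 : Q = 0.
  move: L; rewrite QQ' subrr !mulr0 mul0r -mulrBl => /esym/eqP.
  rewrite !mulf_eq0 oppr_eq0 !intr_eq0 mulf_eq0 subr_eq0.
  by rewrite (negPf u0) (negPf PP') (negPf tau0) /= orbF => /eqP.
(* With [Q = 0] the first equation is [c] times the required relation. *)
exists d, (- u * P); split => //; apply: (mulIf c0).
rewrite rmorphM /= mulrNz; apply/eqP; rewrite -subr_eq0; apply/eqP.
by rewrite -{}E Q0; ring.
Qed.

Lemma connected_neighbor (V : finType) (G : sgraph V) v :
  (2 <= #|V|)%N -> gconnected G -> exists w, adj G v w.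
Proof.
move=> n2 Gc; have [u uv] : exists u, u != v.
  apply/existsP; rewrite -[[exists _, _]]negbK negb_exists.
  apply/negP => /forallP V1.
  move: n2; rewrite ltnNge => /negP; apply; apply/card_le1P => a _ b.
  by have := V1 a; have := V1 b; rewrite !negbK !inE => /eqP-> /eqP->;
     rewrite eqxx.
have /connectP[[|w p] /=] := Gc v u.
  by move=> _ uvE; rewrite uvE eqxx in uv.
by case/andP=> vw _ _; exists w.
Qed.

(** * Descending periodicity from the corona to [G] *)

Section Periodicity.
Variables (R : realType) (V W : finType) (G : sgraph V) (H : sgraph W).
Variable k : nat.
Hypothesis H_regular : gregular H k.

Lemma zero_in_support_commensurable t v w (o : option W) : 0 < t ->
  adj G v w -> (0 < #|W|)%N ->
  (forall (x : V -> Cplx R) (l : R), eigenfun G x (l%:C)%C -> x v != 0 ->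
     l != 0 -> exists mu1 mu2, [/\ mu1 + mu2 = l + k%:R,
      mu1 * mu2 = l * k%:R - #|W|%:R * l ^+ 2,
      expi (t * mu1) = expi (t * (if o is Some _ then k%:R else 0)) &
      expi (t * mu2) = expi (t * (if o is Some _ then k%:R else 0))]) ->
  exists2 N : nat, (0 < N)%N & expi (t * (N%:R * k%:R)) = 1.
Proof.
move=> t0 vw W0 phases.
have [->|k0] := eqVneq k 0%N; first by exists 1%N; rewrite // mulr0 mulr0 expi0.
set e := (if o is Some _ then k%:R else 0) in phases.
pose tau := (pi *+ 2) / t.
have pi2 : 0 < pi *+ 2 :> R by rewrite mulrn_wgt0 ?pi_gt0.
have tau0 : tau != 0 by rewrite gt_eqF // divr_gt0.
pose m : int := #|W|%:Z; have m0 : m != 0 by rewrite -lt0n.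
(* The coefficients obtained by expanding [(mu1 - e) * (mu2 - e)] with [l = P tau - k + 2 e], where
   [e] is [k] on a copy of [H] and [0] on [G]. *)
pose c : int := if o is Some _ then 2 * m else - (1 + 2 * m).
pose d : int := if o is Some _ then m else 1 + m.
have c0 : c != 0 by rewrite /c; case: o {phases e c d} => [?|]; lia.
have d0 : d != 0 by rewrite /d; case: o {phases e c d c0} => [?|]; lia.
have quadratic (x : V -> Cplx R) (l : R) :
    eigenfun G x (l%:C)%C -> x v != 0 -> l != 0 ->
    exists Q P : int, l + k%:R - 2 * e = P%:~R * tau /\
     Q%:~R * tau ^+ 2 + c%:~R * k%:R * P%:~R * tau + d%:~R * k%:R ^+ 2 = 0.
  move=> xl xv l0; have [mu1 [mu2 [muD muM e1 e2]]] := phases x l xl xv l0.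
  have shift mu : expi (t * mu) = expi (t * e) ->
      exists p : int, mu - e = p%:~R * tau.
    move=> mue; have /expi_eq1[p pE] : expi (t * (mu - e)) = 1.
      by rewrite mulrBr expiD mue expi_mulVr.
    by exists p; rewrite /tau mulrA -pE mulrC mulKf // gt_eqF.
  have [p1 p1E] := shift _ e1; have [p2 p2E] := shift _ e2.
  have PE : l + k%:R - 2 * e = (p1 + p2)%:~R * tau.
    by rewrite -muD intrD [RHS]mulrDl -p1E -p2E; ring.
  exists (p1 * p2 + m * (p1 + p2) ^+ 2), (p1 + p2); split => //.
  have lE : l = (p1 + p2)%:~R * tau - k%:R + 2 * e by rewrite -PE; ring.
  have qE : (p1 * p2)%:~R * tau ^+ 2 =
      l * k%:R - #|W|%:R * l ^+ 2 - e * (l + k%:R) + e ^+ 2.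
    rewrite -muM -muD intrM expr2 mulrACA -p1E -p2E; ring.
  have mE : m%:~R = #|W|%:R :> R by rewrite -pmulrn.
  have QE : (p1 * p2 + m * (p1 + p2) ^+ 2)%:~R * tau ^+ 2 =
      (p1 * p2)%:~R * tau ^+ 2 + #|W|%:R * ((p1 + p2)%:~R * tau) ^+ 2.
    by rewrite !(intrD, intrM) mE ?rmorphXn /= ?intrD; ring.
  rewrite {}QE {}qE {}lE /c /d /e.
  by case: o {phases e c d c0 d0 muD muM e1 e2 shift p1E p2E PE} => [w'|];
     rewrite ?mulrNz ?intrD ?intrM mE; ring.
have [x1 [l1 [xl1 xv1 l10 _]]] := nonzero_eigenvalue_outside (0 : R) vw.
have [x2 [l2 [xl2 xv2 l20 l21]]] := nonzero_eigenvalue_outside l1 vw.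
have [Q1 [P1 [PE1 E1]]] := quadratic _ _ xl1 xv1 l10.
have [Q2 [P2 [PE2 E2]]] := quadratic _ _ xl2 xv2 l20.
(* The integer [P] determines [l], so distinct eigenvalues give distinct [P]. *)
have P12 : P1 != P2.
  apply: contra l21 => /eqP P12; move: PE2; rewrite -P12 -PE1.
  by move=> /addIr/addIr->.
have kr0 : k%:R != 0 :> R by rewrite pnatr_eq0.
have [N [z [N0 Nz]]] := quadratic_pair_commensurable tau0 kr0 c0 d0 P12 E1 E2.
exists N; rewrite // Nz mulrCA /tau [t * _]mulrC divfK ?gt_eqF //.
exact: expi_eq1_int.
Qed.

Lemma periodic_corona v w (o : option W) : adj G v w ->
  periodic_at R (ncorona G H) (v, o) -> periodic_at R G v.
Proof.
move=> vw Hp; have [W0|] := posnP #|W|; first exact: corona_empty_periodic Hp.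
move=> W0; have [t [g [t0 g1 Ht]]] := Hp.
have phases := corona_phases H_regular W0 Ht.
have phase2 (x : V -> Cplx R) (l : R) : eigenfun G x (l%:C)%C -> x v != 0 ->
    l != 0 -> expi (t * (l + k%:R)) = g ^+ 2.
  move=> xl xv l0; have [mu1 [mu2 [<- _ e1 e2]]] := phases x l xl xv l0.
  by rewrite mulrDr expiD e1 e2 expr2.
have [[x0 [xl0 xv0]]|supp0] := pselect (exists x : V -> Cplx R,
    eigenfun G x ((0 : R)%:C)%C /\ x v != 0); last first.
  (* Outside the support of [0], [phase2] covers every relevant [l]; the extra factor cancels the
     shift by [k]. *)
  exists t, (g ^+ 2 * expi (- (t * k%:R))); split=> //.
    by rewrite normrM normrX g1 expr1n normr_expi mulr1.
  apply/transition_eigenfun => x l xl.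
  have [->|xv] := eqVneq (x v) 0; first by rewrite !mulr0.
  congr (_ * _); rewrite -(phase2 _ _ xl xv) -?expiD; first by congr expi; ring.
  by apply: contra_notN supp0 => /eqP l0; exists x; rewrite -l0.
have gE := corona_zero_phase H_regular Ht xl0 xv0.
set e := (if o is Some _ then _ else _) in gE.
rewrite gE in phases phase2.
have [N N0 Nk] := zero_in_support_commensurable t0 vw W0 phases.
(* The eigenvalue [0] in the support forces phase [1]. For the others, the [N]-th power of [phase2]
   is [1], and [N] also trivializes the contribution of [k]. *)
exists (t * N%:R), 1; rewrite mulr_gt0 ?ltr0n ?normr1 //; split=> //.
apply/transition_eigenfun => x l xl.
have [->|xv] := eqVneq (x v) 0; first by rewrite !mulr0.
congr (_ * _).
have [->|l0] := eqVneq l 0; first by rewrite mulr0 expi0.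
have Ne : expi (N%:R * (t * e)) = 1.
  by rewrite /e; case: o {Ht Hp phases phase2 gE e} => [w'|];
     rewrite ?mulr0 ?expi0 // mulrCA.
have := congr1 (fun z => z ^+ N) (phase2 _ _ xl xv l0).
rewrite exprAC -(expi_natmul N (t * e)) Ne expr1n -expi_natmul.
rewrite mulrDr mulrDr expiD [N%:R * (t * k%:R)]mulrCA Nk mulr1.
by rewrite mulrCA mulrA.
Qed.

End Periodicity.

Theorem theorem4p5 (R : realType) (V W : finType) (G : sgraph V) (H : sgraph W)
    (k : nat)
    (n_ge2 : (2 <= #|V|)%N)
    (G_connected : gconnected G)
    (H_regular : gregular H k)
    (G_not_periodic : forall v : V, ~ periodic_at R G v) :
  (forall x : V * option W, ~ periodic_at R (ncorona G H) x) /\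
  (forall x y : V * option W,
     x <> y -> ~ perfect_state_transfer R (ncorona G H) x y).
Proof.
have corona_not_periodic x : ~ periodic_at R (ncorona G H) x.
  case: x => v o; have [w vw] := connected_neighbor v n_ge2 G_connected.
  by move=> /(periodic_corona H_regular vw) /G_not_periodic.
split=> // x y _ /perfect_state_transfer_periodic.
exact: corona_not_periodic.
Qed.
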